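(* Let $p$ be a prime number and $n \geq 1$ an integer. Then the set of all solutions $(x,y,z)$ in non-negative integers of the Diophantine equation $$p^x + p^y = z^{2n}$$ is exactly the following. For $n = 1$: - if $p = 2$: the triples $(2s+3,\, 2s,\, 3\cdot 2^s)$, $(2s,\, 2s+3,\, 3\cdot 2^s)$ and $(2s+1,\, 2s+1,\, 2^{s+1})$, where $s$ ranges over all non-negative integers; - if $p = 3$: the triples $(2s+1,\, 2s,\, 2\cdot 3^s)$ and $(2s,\, 2s+1,\, 2\cdot 3^s)$, where $s$ ranges over all non-negative integers; - if $p > 3$: there are no solutions. For $n > 1$: - if $p = 2$: the triples $(2s+1,\, 2s+1,\, 2^{(s+1)/n})$, where $s$ ranges over all non-negative integers with $s+1 \equiv 0 \pmod n$; - if $p \geq 3$: there are no solutions. *)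

(* Defs.v *)
From mathcomp Require Import all_boot.

Set Implicit Arguments.
Unset Strict Implicit.
Unset Printing Implicit Defensive.

(* Main.v *)
(* Comparing p-adic valuations, a square p^x + p^y with x < y has x even, so the
   equation reduces to 1 + p^k = m^2, i.e. p^k = (m - 1)(m + 1). Two powers of p
   that differ by 2 are (1, 3) or (2, 4), giving p = 3 or p = 2. If x = y, the
   2-adic valuation of 2 p^x forces p = 2. For n > 1 the solution z^n = w of the
   case n = 1 is excluded when a prime divides w exactly once. *)

Require Import Defs.
From mathcomp Require Import all_boot.
From mathcomp Require Import zify.

Lemma succ_pfactor_square {p k m : nat} :
  prime p -> 1 + p ^ k = m ^ 2 ->
  [/\ p = 2, k = 3 & m = 3] \/ [/\ p = 3, k = 1 & m = 2].
Proof.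
move=> pr_p eq_m.
have p_gt1 := prime_gt1 pr_p.
have m_gt1 : 1 < m.
  rewrite -(ltn_exp2r 1 m (isT : 0 < 2)) -eq_m -[1 ^ 2]addn0 ltn_add2l.
  by rewrite expn_gt0 prime_gt0.
(* Shifting [m] by one turns the factors m - 1 and m + 1 into [m] and [m.+2], without truncated
   subtraction. *)
case: m m_gt1 eq_m => // m m_gt0 eq_m.
have eq_pk : p ^ k = m * m.+2 by move: eq_m; rewrite -mulnn; lia.
have /(dvdn_pfactor _ _ pr_p)[a _ eq_a] : m %| p ^ k by rewrite eq_pk dvdn_mulr.
have /(dvdn_pfactor _ _ pr_p)[b _ eq_b] : m.+2 %| p ^ k.
  by rewrite eq_pk dvdn_mull.
case: a eq_a => [|a] eq_a.
  have eq_pk3 : p ^ k = 3 by rewrite eq_pk eq_a.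
  have p3 : p = 3.
    have k_gt0 : 0 < k by case: k eq_pk3 {eq_m eq_pk}.
    have : p %| 3 by rewrite -eq_pk3 dvdn_exp.
    by rewrite dvdn_prime2 // => /eqP.
  right; split=> //; last by rewrite eq_a.
  by apply/eqP; rewrite -(eqn_exp2l _ _ (isT : 1 < 3)) -{1}p3 eq_pk3.
have b_gt0 : 0 < b by case: b eq_b.
(* Both exponents are now positive, so [p] divides [m] and [m.+2], hence their difference 2. *)
have p2 : p = 2.
  have : p %| 2.
    rewrite -(dvdn_addr 2 (dvdn_exp (ltn0Sn a) (dvdnn p))) -eq_a addn2 eq_b.
    by rewrite dvdn_exp.
  by rewrite dvdn_prime2 // => /eqP.
rewrite {}p2 in eq_a eq_b eq_pk *.
case: b b_gt0 eq_b => // b _; rewrite eq_a !expnS => eq_b.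
have eq_ab : (2 ^ a).+1 = 2 ^ b by lia.
(* Parity: for positive [a] the left side of [eq_ab] is odd and exceeds 1, so it is no power of
   2. *)
have a0 : a = 0.
  case: a {eq_a eq_b} eq_ab => // a; case: b => [|b]; rewrite ?expnS; last by lia.
  by have := expn_gt0 2 a; lia.
left; rewrite a0; split=> //.
by apply/eqP; rewrite -(eqn_exp2l _ _ (isT : 1 < 2)) eq_pk eq_a a0.
Qed.

Lemma sum_pfactors_square_leq {p x y w : nat} :
  prime p -> x <= y -> p ^ x + p ^ y = w ^ 2 ->
  exists s,
    [\/ [/\ p = 2, x = 2 * s, y = 2 * s + 3 & w = 3 * 2 ^ s],
        [/\ p = 2, x = 2 * s + 1, y = 2 * s + 1 & w = 2 ^ (s + 1)]
      | [/\ p = 3, x = 2 * s, y = 2 * s + 1 & w = 2 * 3 ^ s]].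
Proof.
move=> pr_p le_xy eq_w.
have p_gt0 := prime_gt0 pr_p.
have [eq_xy | neq_xy] := eqVneq x y.
  rewrite -{y le_xy}eq_xy addnn -mul2n in eq_w *.
  have log2_w : 1 + x * logn 2 p = 2 * logn 2 w.
    by rewrite -[2 * _]lognX -eq_w lognM ?expn_gt0 ?p_gt0 // lognX.
  have [p2 | p_neq2] := eqVneq p 2; last first.
    by move: log2_w; rewrite (logn_prime 2 pr_p) eq_sym (negPf p_neq2); lia.
  rewrite {}p2 in eq_w log2_w *.
  have [s def_x] : exists s, x = 2 * s + 1.
    (* For [p = 2] the valuations give 1 + x = 2 * [logn 2 w]; in particular [logn 2 w] is positive
       and its predecessor is not truncated. *)
    by exists (logn 2 w).-1; move: log2_w; rewrite logn_prime // eqxx; lia.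
  exists s; constructor 2; split=> //.
  apply/eqP; rewrite -(eqn_exp2r _ _ (isT : 0 < 2)) -eq_w -expnS -expnM def_x.
  by apply/eqP; congr (_ ^ _); lia.
have lt_xy : x < y by rewrite ltn_neqAle neq_xy.
have [k k_gt0 def_y] : exists2 k, 0 < k & y = x + k by exists (y - x); lia.
have eq_w2 : p ^ x * (1 + p ^ k) = w ^ 2.
  by rewrite -eq_w def_y expnD mulnDr muln1.
(* As [k] is positive, [p] does not divide 1 + p^k, so the left side of [eq_w2] has valuation
   exactly [x]. *)
have def_x : x = 2 * logn p w.
  rewrite -lognX -eq_w2 lognM ?expn_gt0 ?p_gt0 // pfactorK //.
  rewrite [logn p (1 + _)]lognE pr_p dvdn_addl ?dvdn_exp //.
  by rewrite dvdn1 gtn_eqF ?prime_gt1 // andbF addn0.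
have /dvdnP[m def_w] := pfactor_dvdnn p w.
move: (logn p w) def_x def_w => s def_x def_w.
have eq_m : 1 + p ^ k = m ^ 2.
  apply/eqP; rewrite -(eqn_pmul2l (_ : 0 < p ^ x)) ?expn_gt0 ?p_gt0 // eq_w2.
  by rewrite def_w expnMn mulnC -expnM def_x (mulnC s).
exists s; case: (succ_pfactor_square pr_p eq_m) => -[p_val k_val m_val].
  by constructor 1; rewrite def_y def_x k_val def_w m_val p_val.
by constructor 3; rewrite def_y def_x k_val def_w m_val p_val.
Qed.

Lemma sum_pfactors_square {p x y w : nat} :
  prime p -> p ^ x + p ^ y = w ^ 2 ->
  exists s,
    [\/ p = 2 /\ ((x, y, w) = (2 * s + 3, 2 * s, 3 * 2 ^ s) \/
                   (x, y, w) = (2 * s, 2 * s + 3, 3 * 2 ^ s)),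
        p = 2 /\ (x, y, w) = (2 * s + 1, 2 * s + 1, 2 ^ (s + 1))
      | p = 3 /\ ((x, y, w) = (2 * s + 1, 2 * s, 2 * 3 ^ s) \/
                   (x, y, w) = (2 * s, 2 * s + 1, 2 * 3 ^ s))].
Proof.
move=> pr_p eq_w.
have [le_xy | /ltnW le_yx] := leqP x y.
  have [s [] [-> -> -> ->]] := sum_pfactors_square_leq pr_p le_xy eq_w; exists s.
  - by constructor 1; split=> //; right.
  - by constructor 2.
  - by constructor 3; split=> //; right.
(* The equation is symmetric in [x] and [y], so the ordered case applies with the two exchanged. *)
rewrite addnC in eq_w.
have [s [] [-> -> -> ->]] := sum_pfactors_square_leq pr_p le_yx eq_w; exists s.
- by constructor 1; split=> //; left.
- by constructor 2.
- by constructor 3; split=> //; left.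
Qed.

(** Every valuation of an n-th power is a multiple of [n], and 1 is not one when n > 1. *)
Lemma logn1_nonpower {q n w z : nat} :
  1 < n -> logn q w = 1 -> w <> z ^ n.
Proof.
move=> n_gt1 log_w eq_w; move: log_w; rewrite eq_w lognX => /eqP.
by rewrite muln_eq1 gtn_eqF.
Qed.

(** Meant for the families 3 * 2^s and 2 * 3^s, where it supplies the prime occurring exactly
    once. *)
Lemma logn_prime_mul_pfactor {q r s : nat} :
  prime q -> prime r -> q != r -> logn q (q * r ^ s) = 1.
Proof.
move=> pr_q pr_r neq_qr.
rewrite lognM ?expn_gt0 ?prime_gt0 // lognX !logn_prime // eqxx.
by rewrite (negPf neq_qr) muln0.
Qed.

Theorem theorem3p1 (p n : nat) (p_prime : prime p) (n_ge1 : 1 <= n) :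
  (n = 1 ->
     [/\ p = 2 -> forall x y z : nat,
           p ^ x + p ^ y = z ^ (2 * n) <->
           exists s : nat,
             [\/ (x, y, z) = (2 * s + 3, 2 * s, 3 * 2 ^ s),
                 (x, y, z) = (2 * s, 2 * s + 3, 3 * 2 ^ s)
               | (x, y, z) = (2 * s + 1, 2 * s + 1, 2 ^ (s + 1))],
         p = 3 -> forall x y z : nat,
           p ^ x + p ^ y = z ^ (2 * n) <->
           exists s : nat,
             (x, y, z) = (2 * s + 1, 2 * s, 2 * 3 ^ s) \/
             (x, y, z) = (2 * s, 2 * s + 1, 2 * 3 ^ s)
       & 3 < p -> ~ exists x y z : nat, p ^ x + p ^ y = z ^ (2 * n)]) /\
  (1 < n ->
     (p = 2 -> forall x y z : nat,
        p ^ x + p ^ y = z ^ (2 * n) <->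
        exists s : nat,
          s + 1 = 0 %[mod n] /\
          (x, y, z) = (2 * s + 1, 2 * s + 1, 2 ^ ((s + 1) %/ n))) /\
     (3 <= p -> ~ exists x y z : nat, p ^ x + p ^ y = z ^ (2 * n))).
Proof.
split=> [-> | n_gt1].
  rewrite muln1; split=> [p_val x y z | p_val x y z | p_gt3 [x [y [z]]]].
  - split=> [/(sum_pfactors_square p_prime)[s] | [s []] [-> -> ->]].
    + case=> [[_ []] eq_xyz | [_ eq_xyz] | [p3]]; last by rewrite p3 in p_val.
      * by exists s; constructor 1.
      * by exists s; constructor 2.
      * by exists s; constructor 3.
    + by rewrite p_val expnD expnMn -expnM (mulnC s); lia.
    + by rewrite p_val expnD expnMn -expnM (mulnC s); lia.
    + by rewrite p_val -expnM mulnDl mul1n (mulnC s) !expnD; lia.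
  - split=> [/(sum_pfactors_square p_prime)[s] | [s []] [-> -> ->]].
    + by case=> [[p2] | [p2] | [_ eq_xyz]]; [rewrite p2 in p_val.. | exists s].
    + by rewrite p_val expnD expnMn -expnM (mulnC s); lia.
    + by rewrite p_val expnD expnMn -expnM (mulnC s); lia.
  - by move=> /(sum_pfactors_square p_prime)[s [] [p_val]]; rewrite p_val in p_gt3.
(* Reading z^(2n) as (z^n)^2 reduces to the case n = 1 with w = z^n. Only w = 2^(s+1) can be an n-th
   power: 3 divides 3 * 2^s once, and 2 divides 2 * 3^s once. *)
have solve x y z : p ^ x + p ^ y = z ^ (2 * n) ->
    exists s, p = 2 /\ (x, y, z ^ n) = (2 * s + 1, 2 * s + 1, 2 ^ (s + 1)).
  rewrite mulnC expnM => /(sum_pfactors_square p_prime)[s sol]; exists s.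
  case: sol => // -[_ []] [_ _ /esym eq_w]; exfalso;
  by apply: logn1_nonpower n_gt1 _ eq_w; apply: logn_prime_mul_pfactor.
split=> [p2 x y z | p_ge3 [x [y [z /solve[s [p2 _]]]]]]; last by rewrite p2 in p_ge3.
split=> [/solve[s [_ [-> -> eq_zn]]] | [s [s_mod [-> -> ->]]]].
  have def_s : s + 1 = n * logn 2 z by rewrite -lognX eq_zn pfactorK.
  have n_dvd : n %| s + 1 by rewrite def_s dvdn_mulr.
  exists s; split; first by rewrite mod0n; apply/eqP.
  (* Since n-th powers are injective for positive [n], it suffices to compare z^n with 2^(s+1). *)
  congr (_, _, _); apply/eqP.
  by rewrite -(eqn_exp2r _ _ n_ge1) -expnM divnK // eq_zn.
have n_dvd : n %| s + 1 by rewrite /dvdn s_mod mod0n.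
rewrite p2 -expnM (mulnC 2 n) mulnA divnK // addnn -mul2n -expnS.
by congr (_ ^ _); lia.
Qed.
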